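(* Let $S$ be a finite commutative semigroup and $K$ a field. Suppose that either (i) $K$ is a splitting field of $S$, or (ii) ${\rm Char}(K)=p$ and $\exp(S)$ is a power of $p$ for some prime $p$. Then $d(S,K)<\infty$ and $$\max_{a\in S}\{d(\Gamma(H_a),K)\}\le d(S,K)\le\max_{a\in S}\{\epsilon_a\,{\rm D}_{\bar a}(S/\mathcal{H})+d(\Gamma(H_a),K)\}\le\max_{a\in S}\{\epsilon_a(\psi(a)+1)+d(\Gamma(H_a),K)\},$$ where $\epsilon_a=0$ if $\langle a\rangle$ is a group and $\epsilon_a=1$ otherwise, and $\bar a$ is the image of $a$ in $S/\mathcal{H}$. In particular, if $S$ is a Clifford semigroup or an archimedean semigroup, the upper bounds are attained, i.e. $d(S,K)=\max_{a\in S}\{\epsilon_a(\psi(a)+1)+d(\Gamma(H_a),K)\}$.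
   Context: All semigroups are commutative, written additively; $\langle x\rangle=\{mx:m\ge1\}$. For $x$ in a finite semigroup, $e(x)$ is the unique idempotent of $\langle x\rangle$; the index of $x$ is the least $k>0$ with $kx=tx$ for some $t\ne k$, the period is the least $n>0$ with $(k+n)x=kx$; $\exp(S)$ is the lcm of the periods of all elements. A field $K$ is a splitting field of $S$ if $\#\{\zeta\in K:\zeta^n=1\}=n$ where $n=\exp(S)$. The semigroup ring $K[X;S]$ has basis $\{X^s\}$ with $X^sX^t=X^{s+t}$. $d(S,K)$ is the supremum of all $\ell$ such that some sequence $s_1\cdots s_\ell$ over $S$ satisfies $\prod_{i=1}^\ell(X^{s_i}-a_iX^{e(s_i)})\ne0$ in $K[X;S]$ for all nonzero $a_1,\dots,a_\ell\in K$ (for groups $e(g)$ is the identity; $d(\emptyset,K)=0$). $(a)=\{a\}\cup(a+S)$; $a\preceq_{\mathcal H}b$ iff $(a)\subseteq(b)$; $a\,\mathcal{H}\,b$ iff $(a)=(b)$; $H_a$ is the class of $a$; $a\prec_{\mathcal H}b$ means $(a)\subsetneq(b)$. $\psi(a)$ is the largest $\ell$ such that there are $a_1,\dots,a_\ell\in S$ with $(a)\subsetneq(a_1)\subsetneq\cdots\subsetneq(a_\ell)$. ${\rm St}(A)=\{c:c+A\subseteq A\}$; for $c\in{\rm St}(H_a)$, $\gamma_c:H_a\to H_a$, $x\mapsto c+x$; $\Gamma(H_a)=\{\gamma_c:c\in{\rm St}(H_a)\}$ with $\gamma_c+\gamma_d=\gamma_{c+d}$ (Schützenberger group; empty if ${\rm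 St}(H_a)=\emptyset$). For a sequence $T$ with sum $\sigma(T)$, $T$ is irreducible if no proper subsequence (including the empty one) has the same sum; ${\rm D}_b(M)$ is the largest length of an irreducible sequence over $M$ with sum $b$ (and $0$ if $b$ is the identity of a monoid $M$). A commutative semigroup is archimedean if for all $a,b$ there exist $n>0$ and $t\in S$ with $na=t+b$. It is Clifford (commutative regular) if for each $a$ there is $a'$ with $a+a'+a=a$ and $a'+a+a'=a'$. *)

(* Defs.v *)
From HB Require Import structures.
From mathcomp Require Import all_boot.

(* This structure has to be declared before countalg is loaded: Hierarchy
   Builder refuses it once the countable nmodules exist, for lack of a join.
   [addSemigroupType] is commutative by definition. Carriers may be empty,
   because Schützenberger groups may be. *)
#[short(type="finAddSemigroupType")]
HB.structure Definition FinAddSemigroup :=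
  {S of Finite S & Algebra.AddSemigroup S}.

From mathcomp Require Import all_order all_algebra.
From mathcomp Require Import boolp classical_sets cardinality constructive_ereal.

Set Implicit Arguments.
Unset Strict Implicit.
Unset Printing Implicit Defensive.

Import Order.TTheory GRing.Theory Num.Theory.

Local Open Scope ring_scope.
Local Open Scope quotient_scope.

(* Least upper bound in N with +oo adjoined, embedded in \bar int. *)
Definition esup (P : set nat) : \bar int :=
  supremum 0%E [set (n%:Z)%:E | n in P]%classic.

Lemma esup_max (P : set nat) n :
  P n -> (forall m, P m -> (m <= n)%N) -> esup P = (n%:Z)%:E.
Proof.
move=> Pn nmax; set A := [set (m%:Z)%:E | m in P]%classic.
have An : A (n%:Z)%:E by exists n.
have ubA : ubound A (n%:Z)%:E by move=> _ [m Pm <-]; rewrite lee_fin lez_nat nmax.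
rewrite /esup -/A /supremum; case: ifPn => [/eqP A0|_].
  by move: An; rewrite A0.
case: xgetP => [y _ [uby lby]|noA].
  by apply/eqP; rewrite eq_le (lby _ ubA) (uby _ An).
by case: (noA (n%:Z)%:E); split=> // y; apply.
Qed.

Lemma esup_unbounded (P : set nat) :
  (forall n, exists2 m, P m & (n <= m)%N) -> esup P = +oo%E.
Proof.
move=> Punb; set A := [set (m%:Z)%:E | m in P]%classic.
have ubA y : ubound A y -> y = +oo%E.
  case: y => [r uby|//|uby].
    have [m Pm rm] := Punb `|r|%N.+1.
    have := uby _ (ex_intro2 _ _ m Pm erefl); rewrite lee_fin => mr.
    by have := le_trans mr (ler_norm r); rewrite -abszE lez_nat leqNgt rm.
  have [m Pm _] := Punb 0%N.
  by have := uby _ (ex_intro2 _ _ m Pm erefl).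
have ubAy : ubound A +oo%E by move=> x _; exact: leey.
rewrite /esup -/A /supremum; case: ifPn => [/eqP A0|_].
  have [m Pm _] := Punb 0%N.
  by have : A (m%:Z)%:E; [exists m | rewrite A0].
case: xgetP => [y _ [uby _]|noA]; first exact: ubA.
by case: (noA +oo%E); split=> // y /ubA ->.
Qed.

Section Multiples.
Variable S : addSemigroupType.
Implicit Types (x : S) (n : nat).

(* n-fold sum of x, for n > 0; the value at n = 0 is meaningless. *)
Definition nfold n x : S := iterop n +%R x x.

Lemma nfoldS n x : (0 < n)%N -> nfold n.+1 x = x + nfold n x.
Proof. by case: n. Qed.

Lemma nfoldD m n x :
  (0 < m)%N -> (0 < n)%N -> nfold (m + n) x = nfold m x + nfold n x.
Proof.
move=> + n0; elim: m => [//|[|m] IH _]; first by rewrite add1n nfoldS.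
by rewrite addSn nfoldS // IH // (nfoldS (n := m.+1)) // Algebra.addrA.
Qed.

End Multiples.

Section FiniteSemigroup.
Variable S : finAddSemigroupType.
Implicit Types (x y a b c : S) (A : {set S}).

Definition monogenic x : {set S} :=
  [set y | `[< exists2 m, (0 < m)%N & y = nfold m x >]].

Lemma nfold_repeat x :
  exists i n, [/\ (0 < i)%N, (0 < n)%N & nfold (i + n) x = nfold i x].
Proof.
have /injectivePn[i [j ij eqij]] :
    ~~ injectiveb (fun i : 'I_#|S|.+1 => nfold i.+1 x).
  by apply/injectiveP => /leq_card; rewrite card_ord ltnn.
wlog lt_ij : i j ij eqij / (i < j)%N => [hw|].
  case: (ltngtP i j) => [|gt_ij|/val_inj/eqP]; last by rewrite (negPf ij).
    exact: hw.
  by apply: (hw j i) => //; rewrite eq_sym.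
by exists i.+1, (j - i)%N; rewrite subn_gt0 lt_ij addSn subnKC // ltnW.
Qed.

Lemma idem_exists x : exists y, (y + y == y) && (y \in monogenic x).
Proof.
have [i [n [i0 n0 eq_in]]] := nfold_repeat x.
have stepE m : (i <= m)%N -> nfold (m + n) x = nfold m x.
  move=> /subnKC <-; case: (m - i)%N => [|k]; first by rewrite addn0.
  by rewrite addnAC nfoldD ?addn_gt0 ?i0 // eq_in -nfoldD.
have stepsE m k : (i <= m)%N -> nfold (m + k * n) x = nfold m x.
  move=> im; elim: k => [|k IH]; first by rewrite addn0.
  by rewrite mulSnr addnA stepE ?IH // (leq_trans im) ?leq_addr.
have in0 : (0 < i * n)%N by rewrite muln_gt0 i0.
exists (nfold (i * n) x); rewrite -nfoldD // stepsE ?leq_pmulr // eqxx /=.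
by rewrite inE; apply/asboolP; exists (i * n)%N.
Qed.

Definition idem x : S := xchoose (idem_exists x).

Lemma index_exists x : exists k, (0 < k)%N &&
  `[< exists t, [/\ (0 < t)%N, t != k & nfold k x = nfold t x] >].
Proof.
have [i [n [i0 n0 eq_in]]] := nfold_repeat x.
exists i; rewrite i0; apply/asboolP; exists (i + n)%N; split=> //.
  by rewrite addn_gt0 i0.
by rewrite -[X in _ != X]addn0 eqn_add2l -lt0n.
Qed.

Definition sg_index x : nat := ex_minn (index_exists x).

Lemma period_exists x : exists n,
  (0 < n)%N && (nfold (sg_index x + n) x == nfold (sg_index x) x).
Proof.
rewrite /sg_index; case: ex_minnP => k /andP[k0 /asboolP[t [t0 tk kt]]] kmin.
have lekt : (k <= t)%N.
  apply: kmin; rewrite t0; apply/asboolP; exists k.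
  by split; rewrite // eq_sym.
exists (t - k)%N; rewrite subnKC // kt eqxx andbT subn_gt0 ltn_neqAle lekt.
by rewrite eq_sym tk.
Qed.

Definition sg_period x : nat := ex_minn (period_exists x).

Definition principal a : {set S} := a |: [set a + t | t : S].

Definition Hrel : rel S := fun a b => principal a == principal b.

Definition Hclass a : {set S} := [set b | Hrel a b].

Definition psi a : \bar int :=
  esup (fun l => exists2 s : seq S, size s = l &
    path (fun x y => principal x \proper principal y) a s).

Definition St A : {set S} := [set c | [set c + x | x in A] \subset A].

Definition is_group A : Prop :=
  (forall x y, x \in A -> y \in A -> x + y \in A) /\
  exists u, [/\ u \in A, forall x, x \in A -> u + x = x
    & forall x, x \in A -> exists2 y, y \in A & y + x = u].

Definition epsilon a : nat := if `[< is_group (monogenic a) >] then 0%N else 1%N.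

End FiniteSemigroup.

Definition exponent (S : finAddSemigroupType) : nat :=
  \big[lcmn/1%N]_(x : S) sg_period x.

Definition splitting_field (S : finAddSemigroupType) (K : fieldType) : Prop :=
  ([set z : K | z ^+ exponent S = 1]%classic #= `I_(exponent S))%card.

Definition archimedean (S : addSemigroupType) : Prop :=
  forall a b : S, exists n t, (0 < n)%N /\ nfold n a = t + b.

Definition clifford (S : addSemigroupType) : Prop :=
  forall a : S, exists a', a + a' + a = a /\ a' + a + a' = a'.

Section SemigroupRing.
Variables (S : finAddSemigroupType) (K : fieldType).

(* K[X;S] as functions S -> K with convolution; it has no unit in general. *)
Definition sgring := {ffun S -> K^o}.

Definition sgmul (f g : sgring) : sgring :=
  [ffun s => \sum_(p : S * S | p.1 + p.2 == s) f p.1 * g p.2].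

Definition monom (s : S) : sgring := [ffun t => (t == s)%:R].

Lemma monomM s t : sgmul (monom s) (monom t) = monom (s + t).
Proof.
apply/ffunP=> u; rewrite !ffunE (eq_sym u); case: eqP => [<-|stu].
  rewrite (bigD1 (s, t)) //= !ffunE !eqxx mulr1 big1 ?addr0 // => -[x y] /=.
  rewrite xpair_eqE !ffunE => /andP[_].
  by case: (x == s) => /=; [move/negPf->; rewrite mulr0 | rewrite mul0r].
rewrite big1 // => -[x y] /= /eqP xyu; rewrite !ffunE.
case: (x =P s) => [xs|_]; last by rewrite mul0r.
by case: (y =P t) => [yt|_]; rewrite ?mulr0 //; case: stu; rewrite -xs -yt.
Qed.

(* An empty product counts as nonzero, being the (adjoined) unit. *)
Definition sgprod_neq0 (fs : seq sgring) : bool :=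
  if fs is f :: fs' then foldl sgmul f fs' != 0 else true.

Definition dconst : \bar int :=
  esup (fun l => exists s : 'I_l -> S, forall a : 'I_l -> K,
    (forall i, a i != 0) ->
    sgprod_neq0 [seq monom (s i) - a i *: monom (idem (s i)) | i : 'I_l]).

End SemigroupRing.

Section Schutzenberger.
Variables (S : finAddSemigroupType) (a : S).

Definition Hcarrier := {x : S | x \in Hclass a}.

(* f is the translation gamma_c of H_a *)
Definition is_gamma (c : S) (f : {ffun Hcarrier -> Hcarrier}) : bool :=
  [forall x, val (f x) == c + val x].

Definition schutz : Type :=
  {f : {ffun Hcarrier -> Hcarrier} | [exists c in St (Hclass a), is_gamma c f]}.

HB.instance Definition _ := Finite.on schutz.

Lemma StD c d :
  c \in St (Hclass a) -> d \in St (Hclass a) -> c + d \in St (Hclass a).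
Proof.
rewrite !inE => /fintype.subsetP cS /fintype.subsetP dS; apply/fintype.subsetP => _ /imsetP[x xH ->].
by rewrite -Algebra.addrA; apply/cS/imset_f/dS/imset_f.
Qed.

Lemma is_gammaD c d (f g : {ffun Hcarrier -> Hcarrier}) :
  is_gamma c f -> is_gamma d g -> is_gamma (c + d) [ffun x => f (g x)].
Proof.
move=> /forallP fc /forallP gd; apply/forallP => x.
by rewrite ffunE (eqP (fc _)) (eqP (gd _)) Algebra.addrA.
Qed.

Lemma is_gamma_inj c (f g : {ffun Hcarrier -> Hcarrier}) :
  is_gamma c f -> is_gamma c g -> f = g.
Proof.
move=> /forallP fc /forallP gc; apply/ffunP => x; apply/val_inj.
by rewrite (eqP (fc x)) (eqP (gc x)).
Qed.

Lemma schutz_add_subproof (f g : schutz) :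
  [exists c in St (Hclass a), is_gamma c [ffun x => val f (val g x)]].
Proof.
case: f g => [f /= /exists_inP[c cS fc]] [g /= /exists_inP[d dS gd]].
by apply/exists_inP; exists (c + d); [exact: StD | exact: is_gammaD].
Qed.

(* gamma_c + gamma_d = gamma_(c + d), by is_gammaD *)
Definition schutz_add (f g : schutz) : schutz :=
  exist _ [ffun x => val f (val g x)] (schutz_add_subproof f g).

Lemma schutz_addC : commutative schutz_add.
Proof.
case=> [f fP] [g gP]; apply: val_inj => /=.
have /exists_inP[c _ fc] := fP; have /exists_inP[d _ gd] := gP.
apply: (is_gamma_inj (is_gammaD fc gd)); rewrite Algebra.addrC; exact: is_gammaD.
Qed.

Lemma schutz_addA : associative schutz_add.
Proof. by move=> f g h; apply: val_inj; apply/ffunP => x; rewrite !ffunE. Qed.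

HB.instance Definition _ :=
  Algebra.isAddSemigroup.Build schutz schutz_addC schutz_addA.

End Schutzenberger.

Section Quotient.
Variable S : finAddSemigroupType.

Lemma Hrel_equiv : equiv_class_of (@Hrel S).
Proof.
rewrite /Hrel; split=> [a|a b|b a c]; [exact: eqxx | exact: eq_sym |].
by move=> /eqP ->.
Qed.

Canonical Hequiv := EquivRelPack Hrel_equiv.

Definition Hquot : Type := {eq_quot Hequiv}.

HB.instance Definition _ := Choice.on Hquot.
HB.instance Definition _ := EqQuotient.on Hquot.

Lemma principalDS (a b c : S) :
  principal a \subset principal b -> principal (a + c) \subset principal (b + c).
Proof.
move=> /fintype.subsetP ab; have /ab : a \in principal a by rewrite !inE eqxx.
rewrite !inE => /orP[/eqP-> //|/imsetP[t _ ->]].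
apply/fintype.subsetP => x; rewrite !inE => /orP[/eqP->|/imsetP[u _ ->]];
  apply/orP; right; apply/imsetP.
  by exists t => //; rewrite Algebra.addrAC.
by exists (t + u) => //; rewrite Algebra.addrA (Algebra.addrAC b t).
Qed.

Lemma HrelD (a a' b b' : S) : Hrel a a' -> Hrel b b' -> Hrel (a + b) (a' + b').
Proof.
have aux (x x' y : S) : Hrel x x' -> principal (x + y) = principal (x' + y).
  by rewrite /Hrel => /eqP e; apply/eqP; rewrite finset.eqEsubset !principalDS ?e.
by move=> Ha Hb; apply/eqP; rewrite (aux _ _ _ Ha) Algebra.addrC (aux _ _ _ Hb) Algebra.addrC.
Qed.

Definition Hquot_add (A B : Hquot) : Hquot := \pi_Hquot (repr A + repr B).

Lemma Hquot_addE (a b : S) :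
  Hquot_add (\pi_Hquot a) (\pi_Hquot b) = \pi_Hquot (a + b).
Proof. by apply/eqmodP; apply: HrelD; apply/eqmodP; rewrite reprK. Qed.

Lemma Hquot_addC : commutative Hquot_add.
Proof. by move=> A B; rewrite /Hquot_add Algebra.addrC. Qed.

Lemma Hquot_addA : associative Hquot_add.
Proof.
elim/quotW=> a; elim/quotW=> b; elim/quotW=> c.
rewrite (Hquot_addE b c) (Hquot_addE a b) (Hquot_addE a) (Hquot_addE _ c).
by rewrite Algebra.addrA.
Qed.

HB.instance Definition _ :=
  Algebra.isAddSemigroup.Build Hquot Hquot_addC Hquot_addA.

Definition Hbar (a : S) : Hquot := \pi_Hquot a.

End Quotient.

Section Davenport.
Variable M : addSemigroupType.
Implicit Types (b : M) (T : seq M).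

(* The empty sequence has a sum only if M has an identity element. *)
Definition has_sum T b : Prop :=
  if T is x :: T' then foldl +%R x T' = b else forall y, b + y = y.

(* Since M is commutative, order-preserving subsequences suffice. *)
Definition irreducible_with_sum b T : Prop :=
  has_sum T b /\ forall T', subseq T' T -> T' != T -> ~ has_sum T' b.

(* If b is the identity, only the empty sequence qualifies, so the value is 0. *)
Definition davenport b : \bar int :=
  esup (fun l => exists2 T, size T = l & irreducible_with_sum b T).

End Davenport.

(* Main.v *)
Require Import Defs.
From HB Require Import structures.
From mathcomp Require Import all_boot all_order all_algebra.
From mathcomp Require Import boolp classical_sets cardinality constructive_ereal.

Set Implicit Arguments.
Unset Strict Implicit.
Unset Printing Implicit Defensive.

Import Order.TTheory GRing.Theory Num.Theory.

Local Open Scope ring_scope.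

(** Acting on a point of H_a embeds K[Gamma(H_a)] into K[X;S] compatibly with the
    translations, so a product that survives in K[Gamma(H_a)] survives in K[X;S].

    Conversely, let T have sum b. Since e(s) is a multiple of s, all terms of the
    product over T lie in the ideal (b). If b is not in a group, choose a
    subsequence T1 of T that is irreducible with sum b in S/H; the remaining
    elements c satisfy b <= b + c <= b in the H-order, so they stabilise H_b, and
    if their product dies in K[Gamma(H_b)] then it kills X^b and hence the whole
    ideal (b), which contains the support of the product over T1. If b is in a
    group, every element of T stabilises H_b and the product over T is fixed by
    X^(e(b)), so T1 may be taken empty. The partial sums of T1 form a strict chain
    of ideals, which gives psi.

    Finiteness only uses that 'X^n - 1 splits over K for n = exp(S): a long
    sequence repeats some s often, and suitable factors X^s - z X^(e(s)) multiply
    to 0.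

    In an archimedean semigroup with idempotent e, an element a outside the group
    e + S has an empty Schützenberger group; a chain of ideals above a writes a as
    a sum of psi(a) + 1 elements, and X^a survives in their product because all
    other terms lie in K[X;e+S]. *)

(** * Least upper bounds *)

(** The order properties below are read off this trichotomy (empty, bounded, unbounded) without
    unfolding [supremum]. *)
Lemma esup_spec (P : set nat) :
  [\/ (forall n, ~ P n) /\ esup P = 0%E,
      exists n, [/\ P n, forall m, P m -> (m <= n)%N & esup P = n%:Z%:E]
    | (forall n, exists2 m, P m & (n <= m)%N) /\ esup P = +oo%E].
Proof.
have [[n0 Pn0]|P0] := pselect (exists n, P n); last first.
  have noP n : ~ P n by move=> Pn; apply: P0; exists n.
  apply: Or31; split=> //; rewrite /esup /supremum; case: ifPn => // /eqP[].
  by apply/seteqP; split=> [x [n /noP]|x].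
have [[n nub]|Punb] := pselect (exists n, forall m, P m -> (m <= n)%N); last first.
  have unb n : exists2 m, P m & (n <= m)%N.
    apply: contrapT => nm; apply: Punb; exists n => m Pm.
    by rewrite leqNgt; apply/negP => nltm; apply: nm; exists m => //; exact: ltnW.
  by apply: Or33; split=> //; exact: esup_unbounded.
have exP : exists m, `[< P m >] by exists n0; apply/asboolP.
have ubP m : `[< P m >] -> (m <= n)%N by move=> /asboolP; exact: nub.
case: (ex_maxnP exP ubP) => m /asboolP Pm mmax; apply: Or32; exists m.
have maxm k : P k -> (k <= m)%N by move=> Pk; apply: mmax; exact/asboolP.
by split=> //; exact: esup_max.
Qed.

Lemma esup_ub (P : set nat) n : P n -> (n%:Z%:E <= esup P)%E.
Proof.
move=> Pn; have [[/(_ n)//]|[m [_ mub ->]]|[_ ->]] := esup_spec P.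
  by rewrite lee_fin lez_nat mub.
exact: leey.
Qed.

Lemma esup_ge0 (P : set nat) : (0 <= esup P)%E.
Proof.
by have [[_ ->]|[m [_ _ ->]]|[_ ->]] := esup_spec P; rewrite ?leey // lee_fin.
Qed.

Lemma esup_le (P : set nat) y :
  (0 <= y)%E -> (forall n, P n -> (n%:Z%:E <= y)%E) -> (esup P <= y)%E.
Proof.
move=> y0 Py; have [[_ ->]//|[m [Pm _ ->]]|[unb ->]] := esup_spec P; first exact: Py.
case: y y0 Py => [r|//|//] r0 Py.
have [m /Py] := unb `|r|%N.+1; rewrite lee_fin => mr rm.
by have := le_trans mr (ler_norm r); rewrite -abszE lez_nat leqNgt rm.
Qed.

(** Serves the term [psi a + 1]. The supremum of the empty set is 0, so a member of [P] is required
    to get [1 <= y]. *)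
Lemma esup_succ_le (P : set nat) y :
  P 0%N -> (forall n, P n -> (n.+1%:Z%:E <= y)%E) -> (esup P + 1 <= y)%E.
Proof.
move=> P0 Py; have [[/(_ 0%N)//]|[m [Pm _ ->]]|[unb _]] := esup_spec P.
  by rewrite -EFinD; have := Py _ Pm; rewrite -addn1 PoszD.
case: y Py => [r|//|] Py; last by have := Py _ P0.
  have [m /Py] := unb `|r|%N.+1; rewrite lee_fin => mr rm.
  have := le_trans mr (ler_norm r); rewrite -abszE lez_nat leqNgt ltnS.
  by rewrite (leq_trans _ rm).
by rewrite leey.
Qed.

(** * Multiples and idempotents *)

Section Multiples.
Variable S : addSemigroupType.
Implicit Types x y : S.

Lemma nfold_add m x y : (0 < m)%N -> nfold m (x + y) = nfold m x + nfold m y.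
Proof.
elim: m => [//|[//|m] IH _].
by rewrite nfoldS // IH // Algebra.addrACA -!nfoldS.
Qed.

Lemma nfold_mul m k x :
  (0 < m)%N -> (0 < k)%N -> nfold (m * k) x = nfold m (nfold k x).
Proof.
move=> + k0; elim: m => [//|[_|m IH _]]; first by rewrite mul1n.
by rewrite mulSn nfoldD ?muln_gt0 // IH // -nfoldS.
Qed.

Lemma nfold_id m x : x + x = x -> nfold m x = x.
Proof. by move=> xx; elim: m => [//|[//|m] IH]; rewrite nfoldS // IH. Qed.

Lemma nfold_absorb m x y : (0 < m)%N -> x + y = y -> nfold m x + y = y.
Proof.
move=> + xy; elim: m => [//|[//|m] IH _].
by rewrite nfoldS // -Algebra.addrA IH.
Qed.

End Multiples.

Section FiniteSemigroup.
Variable S : finAddSemigroupType.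
Implicit Types x y a b c : S.

Lemma idemD x : idem x + idem x = idem x.
Proof. by have /andP[/eqP] := xchooseP (idem_exists x). Qed.

Lemma idem_nfold x : exists2 m, (0 < m)%N & idem x = nfold m x.
Proof. by have /andP[_] := xchooseP (idem_exists x); rewrite inE => /asboolP. Qed.

Lemma idem_uniq x y m : (0 < m)%N -> y = nfold m x -> y + y = y -> y = idem x.
Proof.
move=> m0 yx yy; have [k k0 ex] := idem_nfold x.
rewrite -(nfold_id k yy) yx -nfold_mul // mulnC nfold_mul // -ex nfold_id //.
exact: idemD.
Qed.

Lemma idem_absorb x y : x + y = y -> idem x + y = y.
Proof. by move=> xy; have [m m0 ->] := idem_nfold x; exact: nfold_absorb. Qed.

Lemma monogenicP x y :
  reflect (exists2 m, (0 < m)%N & y = nfold m x) (y \in monogenic x).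
Proof. by rewrite inE; exact: asboolP. Qed.

Lemma epsilon0 a : idem a + a = a -> epsilon a = 0%N.
Proof.
move=> ea; rewrite /epsilon; case: ifPn => // /asboolPn[]; split.
  move=> x y /monogenicP[m m0 ->] /monogenicP[n n0 ->].
  by apply/monogenicP; exists (m + n)%N; rewrite ?addn_gt0 ?m0 // nfoldD.
have [k k0 ek] := idem_nfold a; exists (idem a).
have eax m : (0 < m)%N -> idem a + nfold m a = nfold m a.
  by move=> m0; rewrite -{1}(nfold_id m (idemD a)) -nfold_add // ea.
split; first by apply/monogenicP; exists k.
  by move=> x /monogenicP[m m0 ->]; exact: eax.
move=> x /monogenicP[m m0 ->].
(* Adding m a gives (m + 1)(k + 1) a, a multiple of the idempotent (k + 1) a; the summand k + 1
   keeps the multiplicity positive. *)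
case: k k0 ek => // k _ ek; exists (nfold (m * k + k.+1)%N a).
  by apply/monogenicP; exists (m * k + k.+1)%N; rewrite ?addnS.
rewrite -nfoldD ?addnS // -addnS -addnA [(k.+1 + m)%N]addnC addnA -mulnSr.
by rewrite nfoldD ?muln_gt0 ?m0 // nfold_mul // -ek nfold_id ?idemD.
Qed.

Lemma epsilon1 a : idem a + a <> a -> epsilon a = 1%N.
Proof.
move=> nea; rewrite /epsilon; case: ifPn => // /asboolP[_ [u [uM uid _]]].
case: nea; have aM : a \in monogenic a by apply/monogenicP; exists 1%N.
have /monogenicP[m m0 um] := uM.
by rewrite -(idem_uniq m0 um (uid _ uM)) uid.
Qed.

Lemma principalP a y :
  reflect (y = a \/ exists t, y = a + t) (y \in principal a).
Proof.
rewrite !inE; apply: (iffP orP) => -[].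
- by move=> /eqP; left.
- by case/imsetP => t _ ->; right; exists t.
- by move=> ->; left.
- by case=> t ->; right; apply/imsetP; exists t.
Qed.

Lemma principal_refl a : a \in principal a.
Proof. by apply/principalP; left. Qed.

Lemma principalD a t : a + t \in principal a.
Proof. by apply/principalP; right; exists t. Qed.

Lemma principal_trans a b c :
  a \in principal b -> b \in principal c -> a \in principal c.
Proof.
move=> /principalP[->//|[t ->]] /principalP[->|[u ->]]; first exact: principalD.
by rewrite -Algebra.addrA principalD.
Qed.

Lemma principal_sub a b : (principal a \subset principal b) = (a \in principal b).
Proof.
apply/idP/idP => [/fintype.subsetP|ab]; first by apply; exact: principal_refl.
by apply/fintype.subsetP => x /principal_trans; apply.
Qed.

Lemma HrelE a b : Hrel a b = (a \in principal b) && (b \in principal a).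
Proof. by rewrite /Hrel finset.eqEsubset !principal_sub. Qed.

Lemma Hrel_refl a : Hrel a a. Proof. exact: eqxx. Qed.

Lemma Hrel_trans a b c : Hrel a b -> Hrel b c -> Hrel a c.
Proof. by rewrite /Hrel => /eqP->. Qed.

Lemma Hrel_sym a b : Hrel a b = Hrel b a.
Proof. exact: eq_sym. Qed.

Lemma principal_absorb x a b : x + a = a -> b \in principal a -> x + b = b.
Proof. by move=> xa /principalP[->|[t ->]] //; rewrite Algebra.addrA xa. Qed.

Lemma nfold_principal m a : (0 < m)%N -> nfold m a \in principal a.
Proof.
by case: m => [//|[_|m _]]; [exact: principal_refl | rewrite nfoldS // principalD].
Qed.

Lemma idem_principal a : idem a \in principal a.
Proof. by have [m m0 ->] := idem_nfold a; exact: nfold_principal. Qed.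

Lemma principal_add a b x y :
  x \in principal a -> y \in principal b -> x + y \in principal (a + b).
Proof.
move=> /principalP[->|[t ->]] /principalP[->|[u ->]].
- exact: principal_refl.
- by rewrite Algebra.addrA principalD.
- by rewrite Algebra.addrAC principalD.
- by rewrite Algebra.addrACA principalD.
Qed.

(** As a lies in (a + a), some u in (a) satisfies u + a = a. If e(a) = m a, then m u lies in (e(a)),
    so e(a) absorbs m u and hence also a = m u + a. *)
Lemma Hrel_double a : Hrel (a + a) a -> idem a + a = a.
Proof.
rewrite HrelE => /andP[_ a2].
have [u [/= au ua]] : exists u, u \in principal a /\ u + a = a.
  move/principalP: a2 => [e|[t e]]; first by exists a; split; [exact: principal_refl|].
  by exists (a + t); rewrite principalD Algebra.addrAC -e.
have [m m0 em] := idem_nfold a.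
have amu : nfold m u \in principal (idem a).
  rewrite em; elim: (m) m0 => [//|[//|k] IH _].
  by rewrite !(nfoldS (n := k.+1)) // principal_add // IH.
have := nfold_absorb m0 ua; move/principalP: amu => [->//|[t ->]] e.
by rewrite -{2}e !Algebra.addrA idemD e.
Qed.

(** H is a congruence, so a translation that keeps one element of the class inside it keeps all of
    them. *)
Lemma St_Hclass a b c :
  Hrel b a -> Hrel (c + b) b -> c \in St (Hclass a).
Proof.
move=> ba cb; rewrite inE; apply/fintype.subsetP => _ /imsetP[x + ->]; rewrite !inE => ax.
rewrite Hrel_sym; apply: (Hrel_trans _ ba); apply: (Hrel_trans _ cb).
by apply: HrelD (Hrel_refl c) _; rewrite Hrel_sym (Hrel_trans ba).
Qed.

End FiniteSemigroup.

(** * Reordering sequences *)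

Lemma perm_map_lift (X Y : eqType) (f : X -> Y) s t :
  perm_eq (map f s) t -> exists2 s', perm_eq s' s & map f s' = t.
Proof.
case: s => [|x0 s]; first by move=> /perm_size/esym/size0nil->; exists [::].
rewrite perm_sym => /(perm_iotaP (f x0))[Is pIs ->]; rewrite size_map in pIs.
exists (map (nth x0 (x0 :: s)) Is); last first.
  rewrite -map_comp; apply/eq_in_map => i; rewrite (perm_mem pIs) mem_iota => iI.
  by rewrite (nth_map x0).
rewrite -[X in perm_eq _ X](mkseq_nth x0); exact: perm_map.
Qed.

Section FoldAC.
Variables (X : eqType) (op : X -> X -> X).
Hypotheses (opA : associative op) (opC : commutative op).

Lemma foldlM x y s : foldl op (op x y) s = op x (foldl op y s).
Proof. by elim: s y => //= z s IH y; rewrite -opA IH. Qed.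

Lemma perm_foldl x s t : perm_eq s t -> foldl op x s = foldl op x t.
Proof.
move=> pst; apply: (catCA_perm_ind (P := fun r => foldl op x s = foldl op x r) _ pst).
  move=> s1 s2 s3 ->; rewrite !foldl_cat; congr foldl.
  elim: s2 x {pst} => //= y s2 IH x.
  by rewrite -IH; congr foldl; rewrite opC -foldlM opC.
by [].
Qed.

(** Without a unit, a sum or product starts from its first term, and a permutation may change that
    term. *)
Lemma perm_foldl_cons x y s t :
  perm_eq (x :: s) (y :: t) -> foldl op x s = foldl op y t.
Proof.
have [->|xy] := eqVneq x y; first by rewrite perm_cons; exact: perm_foldl.
move=> pst.
have ys : y \in s by have := perm_mem pst y; rewrite !inE eqxx eq_sym (negPf xy).
have pr := perm_to_rem ys.
have pr' : perm_eq t (x :: rem y s).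
  rewrite -(perm_cons y) -(permPl pst) (permPr (_ : perm_eq _ (x :: y :: rem y s))).
    by rewrite perm_cons.
  by apply/permP => p /=; rewrite addnCA.
by rewrite (perm_foldl x pr) (perm_foldl y pr') /= opC.
Qed.

End FoldAC.

(** * The semigroup ring *)

Section SemigroupRing.
Variables (S : finAddSemigroupType) (K : fieldType).
Notation sgring := (sgring S K).
Notation monom := (monom K).
Implicit Types (f g h : sgring) (s t u : S) (fs : seq sgring).

Lemma sgring_sum f : f = \sum_u f u *: monom u.
Proof.
apply/ffunP=> v; rewrite sum_ffunE (bigD1 v) //= !ffunE eqxx [_ *: _]mulr1.
by rewrite big1 ?addr0 // => u uv; rewrite !ffunE eq_sym (negPf uv) [_ *: _]mulr0.
Qed.

Lemma sgring_ind (P : sgring -> Prop) :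
  (forall f g, P f -> P g -> P (f + g)) -> (forall a f, P f -> P (a *: f)) ->
  P 0 -> (forall s, P (monom s)) -> forall f, P f.
Proof.
move=> PD PZ P0 PM f; rewrite (sgring_sum f).
by apply: (big_ind P) => // u _; exact: PZ.
Qed.

Lemma sgmulC f g : sgmul f g = sgmul g f.
Proof.
apply/ffunP=> u; rewrite !ffunE (reindex (fun p : S * S => (p.2, p.1))) /=.
  by apply: eq_big => [p|p _]; [rewrite Algebra.addrC | rewrite mulrC].
by exists (fun p => (p.2, p.1)) => -[].
Qed.

Lemma sgmulDl f g h : sgmul (f + g) h = sgmul f h + sgmul g h.
Proof.
apply/ffunP=> u; rewrite !ffunE -big_split /=.
by apply: eq_bigr => p _; rewrite !ffunE mulrDl.
Qed.

Lemma sgmulZl a f g : sgmul (a *: f) g = a *: sgmul f g.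
Proof.
apply/ffunP=> u; rewrite !ffunE scaler_sumr.
by apply: eq_bigr => p _; rewrite !ffunE [RHS]mulrA.
Qed.

Lemma sgmul0l f : sgmul 0 f = 0.
Proof. by have := sgmulZl 0 0 f; rewrite !scale0r. Qed.

Lemma sgmulDr f g h : sgmul h (f + g) = sgmul h f + sgmul h g.
Proof. by rewrite sgmulC sgmulDl !(sgmulC h). Qed.

Lemma sgmulZr a f g : sgmul f (a *: g) = a *: sgmul f g.
Proof. by rewrite sgmulC sgmulZl sgmulC. Qed.

Lemma sgmul0r f : sgmul f 0 = 0.
Proof. by rewrite sgmulC sgmul0l. Qed.

Lemma sgmulNl f g : sgmul (- f) g = - sgmul f g.
Proof. by rewrite -scaleN1r sgmulZl scaleN1r. Qed.

Lemma sgmulNr f g : sgmul f (- g) = - sgmul f g.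
Proof. by rewrite sgmulC sgmulNl sgmulC. Qed.

(** Trilinearity reduces this to monomials, where it is associativity in S. *)
Lemma sgmulA f g h : sgmul f (sgmul g h) = sgmul (sgmul f g) h.
Proof.
elim/sgring_ind: f => [f f' If If'|a f If||s]; rewrite ?(sgmulDl, sgmulZl, sgmul0l).
- by rewrite If If'.
- by rewrite If.
- by [].
elim/sgring_ind: g => [g g' Ig Ig'|a g Ig||t];
  rewrite ?(sgmulDr, sgmulZr, sgmul0r, sgmulDl, sgmulZl, sgmul0l, sgmulDr, sgmulZr, sgmul0r).
- by rewrite Ig Ig'.
- by rewrite Ig.
- by [].
elim/sgring_ind: h => [h h' Ih Ih'|a h Ih||u]; rewrite ?(sgmulDr, sgmulZr, sgmul0r).
- by rewrite Ih Ih'.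
- by rewrite Ih.
- by [].
by rewrite !monomM Algebra.addrA.
Qed.

Lemma sgmulAC f g h : sgmul (sgmul f g) h = sgmul (sgmul f h) g.
Proof. by rewrite -!sgmulA (sgmulC g). Qed.

Lemma sgmul_supp (A B C : {set S}) f g :
  (forall u, f u != 0 -> u \in A) -> (forall u, g u != 0 -> u \in B) ->
  (forall x y, x \in A -> y \in B -> x + y \in C) ->
  forall u, sgmul f g u != 0 -> u \in C.
Proof.
move=> fA gB ABC u; apply: contraNT => uC; rewrite ffunE big1 // => -[x y] /= /eqP xy.
have [->|/fA xA] := eqVneq (f x) 0; first by rewrite mul0r.
have [->|/gB yB] := eqVneq (g y) 0; first by rewrite mulr0.
by case/negP: uC; rewrite -xy ABC.
Qed.

Lemma foldl_sgmulD fs f g :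
  foldl (@sgmul S K) (f + g) fs = foldl (@sgmul S K) f fs + foldl (@sgmul S K) g fs.
Proof. by elim: fs f g => //= h fs IH f g; rewrite sgmulDl IH. Qed.

Lemma foldl_sgmulZ fs a f :
  foldl (@sgmul S K) (a *: f) fs = a *: foldl (@sgmul S K) f fs.
Proof. by elim: fs f => //= h fs IH f; rewrite sgmulZl IH. Qed.

Lemma foldl_sgmul0 fs : foldl (@sgmul S K) 0 fs = 0.
Proof. by have := foldl_sgmulZ fs 0 0; rewrite !scale0r. Qed.

Lemma foldl_sgmulM fs f g :
  foldl (@sgmul S K) (sgmul f g) fs = sgmul f (foldl (@sgmul S K) g fs).
Proof. exact: foldlM sgmulA _ _ _. Qed.

Lemma foldl_sgmul_supp fs f :
  (forall u, f u != 0 -> foldl (@sgmul S K) (monom u) fs = 0) ->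
  foldl (@sgmul S K) f fs = 0.
Proof.
move=> fs0; rewrite (sgring_sum f).
apply: (big_ind (fun g => foldl (@sgmul S K) g fs = 0)) => [|g h g0 h0|u _].
- exact: foldl_sgmul0.
- by rewrite foldl_sgmulD g0 h0 addr0.
rewrite foldl_sgmulZ; have [->|/fs0->] := eqVneq (f u) 0; rewrite ?scale0r //.
exact: scaler0.
Qed.

Lemma sgprod_neq0_perm fs fs' : perm_eq fs fs' -> sgprod_neq0 fs = sgprod_neq0 fs'.
Proof.
case: fs fs' => [|f fs] [|f' fs'] // pfs; try by have := perm_size pfs.
by rewrite /sgprod_neq0 (perm_foldl_cons sgmulA sgmulC pfs).
Qed.

Lemma sgprod_neq0_catl fs fs' : sgprod_neq0 (fs ++ fs') -> sgprod_neq0 fs.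
Proof.
case: fs => //= f fs; rewrite foldl_cat; apply: contraNN => /eqP->.
by rewrite foldl_sgmul0.
Qed.

(** Takes a pair, so that terms and their coefficients are permuted together. *)
Definition dfactor (z : S * K) : sgring := monom z.1 - z.2 *: monom (idem z.1).

Definition survives (T : seq S) : Prop := forall A : seq K, size A = size T ->
  all (fun a => a != 0) A -> sgprod_neq0 (map dfactor (zip T A)).

(** The set whose [esup] is [dconst S K]; [dsetP] recasts it with sequences in place of families. *)
Definition dset : set nat := fun l =>
  exists s : 'I_l -> S, forall a : 'I_l -> K, (forall i, a i != 0) ->
  sgprod_neq0 [seq monom (s i) - a i *: monom (idem (s i)) | i : 'I_l].

Lemma dsetP l : dset l <-> exists2 T, size T = l & survives T.
Proof.
split=> [[s sP]|[T <- TP]].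
  exists (codom s); first by rewrite size_codom card_ord.
  move=> A; rewrite size_codom card_ord => sA nzA.
  have sE (i : 'I_l) : (i < size A)%N by rewrite sA.
  have AE : A = [seq A`_i | i : 'I_l].
    apply: (@eq_from_nth _ 0) => [|i]; rewrite ?size_image ?card_ord sA // => iA.
    rewrite (nth_map (Ordinal iA)) ?size_enum_ord //.
    by rewrite nth_enum_ord.
  rewrite [in zip _ _]AE /codom /image_mem zip_map -map_comp.
  by apply: (sP (fun i => A`_i)) => i; exact: (all_nthP 0 nzA).
exists (tnth (in_tuple T)) => a nza.
have := TP (codom a); rewrite size_codom card_ord => /(_ erefl).
have -> : zip T (codom a) = [seq (tnth (in_tuple T) i, a i) | i : 'I_(size T)].
  transitivity (zip (map (tnth (in_tuple T)) (enum 'I_(size T))) (codom a)).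
    by rewrite map_tnth_enum.
  by rewrite /codom /image_mem zip_map.
by rewrite -map_comp; apply; apply/allP => _ /codomP[i ->].
Qed.

Lemma survives_perm T T' : perm_eq T T' -> survives T -> survives T'.
Proof.
move=> pT TP A sA nzA.
have : perm_eq (map fst (zip T' A)) T by rewrite [map _ _]unzip1_zip ?sA // perm_sym.
case/perm_map_lift => Z pZ ZT; rewrite -(sgprod_neq0_perm (perm_map dfactor pZ)).
rewrite -(zip_unzip Z) [unzip1 _]ZT; apply: TP; first by rewrite -ZT !size_map.
rewrite all_map; apply/allP => z; rewrite (perm_mem pZ) => zZ /=.
apply: (allP nzA); rewrite -(unzip2_zip (s := T') (t := A)) ?sA //.
exact: map_f.
Qed.

Lemma not_survives T : ~ survives T -> exists A, [/\ size A = size T,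
  all (fun a => a != 0) A & ~~ sgprod_neq0 (map dfactor (zip T A))].
Proof.
move=> nT; apply: contrapT => nA; apply: nT => A sA nzA; apply: contrapT => /negP nz.
by apply: nA; exists A.
Qed.

Lemma monom_absorb e f :
  (forall u, f u != 0 -> e + u = u) -> sgmul (monom e) f = f.
Proof.
move=> ef; rewrite {1}(sgring_sum f) (big_morph _ (fun g h => sgmulDr g h _) (sgmul0r _)).
rewrite [RHS]sgring_sum; apply: eq_bigr => u _; rewrite sgmulZr monomM.
by have [->|/ef->//] := eqVneq (f u) 0; rewrite !scale0r.
Qed.

Lemma dfactor_supp z u : dfactor z u != 0 -> u \in principal z.1.
Proof.
apply: contraNT => uz; rewrite !ffunE.
have -> : (u == z.1) = false by apply: contraNF uz => /eqP->; exact: principal_refl.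
have -> : (u == idem z.1) = false by apply: contraNF uz => /eqP->; exact: idem_principal.
by rewrite [_ *: _]mulr0 subr0.
Qed.

Lemma foldl_dfactor_supp (x : S) f (Z : seq (S * K)) :
  (forall u, f u != 0 -> u \in principal x) ->
  forall u, foldl (@sgmul S K) f (map dfactor Z) u != 0 ->
    u \in principal (foldl +%R x (unzip1 Z)).
Proof.
elim: Z x f => //= z Z IH x f fx; apply: IH.
by apply: sgmul_supp fx (@dfactor_supp z) _ => v w; exact: principal_add.
Qed.

End SemigroupRing.

(** * Schützenberger groups *)

Section Schutzenberger.
Variables (S : finAddSemigroupType) (K : fieldType) (a : S).
Implicit Types (c d : S) (g : schutz a) (x : Hcarrier a).

(** A relation, since several c may induce the same translation g. *)
Definition translates c g := is_gamma c (val g).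

Lemma translatesE c g x : translates c g -> val (val g x) = c + val x.
Proof. by move/forallP/(_ x)/eqP. Qed.

Lemma translates_inj c g g' : translates c g -> translates c g' -> g = g'.
Proof. by move=> cg cg'; apply: val_inj; exact: is_gamma_inj cg cg'. Qed.

Lemma translatesD c d g g' :
  translates c g -> translates d g' -> translates (c + d) (g + g').
Proof. exact: is_gammaD. Qed.

Lemma translates_nfold c g m :
  (0 < m)%N -> translates c g -> translates (nfold m c) (nfold m g).
Proof.
move=> + cg; elim: m => [//|[//|m] IH _].
by rewrite !(nfoldS (n := m.+1)) //; apply: translatesD (IH _).
Qed.

(** The multiple m c = e(c) induces m g, which is idempotent because e(c) is, so it can only be
    e(g). This matches the second terms of the factors over S and over the group. *)
Lemma translates_idem c g : translates c g -> translates (idem c) (idem g).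
Proof.
move=> cg; have [m m0 ec] := idem_nfold c.
have eg : translates (idem c) (nfold m g) by rewrite ec; exact: translates_nfold.
rewrite -(idem_uniq m0 erefl (translates_inj _ eg)) //.
by rewrite -[idem c]idemD; exact: translatesD.
Qed.

Lemma translates_lift c : c \in St (Hclass a) -> exists g, translates c g.
Proof.
move=> cS; have cH x : c + val x \in Hclass a.
  move: cS; rewrite inE => /fintype.subsetP; apply; apply/imsetP; exists (val x) => //.
  exact: valP.
pose f : {ffun Hcarrier a -> Hcarrier a} := [ffun x => exist _ (c + val x) (cH x)].
have cf : is_gamma c f by apply/forallP => x; rewrite ffunE.
have fP : [exists c in St (Hclass a), is_gamma c f] by apply/exists_inP; exists c.
by exists (exist _ f fP).
Qed.

Lemma translates_repr g : exists2 c, c \in St (Hclass a) & translates c g.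
Proof. by case: g => f fP; have /exists_inP[c cS cf] := fP; exists c. Qed.

(* An element of the class generates the same ideal as any other one, so a
   translation is determined by its value at a single point. *)
Lemma schutz_free g g' x : val g x = val g' x -> g = g'.
Proof.
have [c _ cg] := translates_repr g; have [d _ dg] := translates_repr g'.
move=> /(congr1 val); rewrite (translatesE x cg) (translatesE x dg) => cdx.
apply: (translates_inj cg); apply/forallP => y; rewrite (translatesE y dg).
have : val y \in principal (val x).
  have ax : Hrel (val x) a by rewrite Hrel_sym; have := valP x; rewrite inE.
  have ay : Hrel a (val y) by have := valP y; rewrite inE.
  by have := Hrel_trans ax ay; rewrite HrelE => /andP[].
by move=> /principalP[->|[t ->]]; rewrite ?Algebra.addrA cdx.
Qed.

(** Acting on a point avoids a choice of representatives. The map need not be multiplicative; it is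
    linear and turns multiplication by X^g into multiplication by X^c. *)
Definition orbit_map x (h : sgring (schutz a) K) : sgring S K :=
  \sum_g h g *: monom K (val (val g x)).

Lemma orbit_mapD x h h' : orbit_map x (h + h') = orbit_map x h + orbit_map x h'.
Proof. by rewrite -big_split; apply: eq_bigr => g _; rewrite ffunE scalerDl. Qed.

Lemma orbit_mapZ x z h : orbit_map x (z *: h) = z *: orbit_map x h.
Proof. by rewrite scaler_sumr; apply: eq_bigr => g _; rewrite ffunE scalerA. Qed.

Lemma orbit_map0 x : orbit_map x 0 = 0.
Proof. by have := orbit_mapZ x 0 0; rewrite !scale0r. Qed.

Lemma orbit_map_monom x g : orbit_map x (monom K g) = monom K (val (val g x)).
Proof.
rewrite /orbit_map (bigD1 g) //= big1 => [|g' g'g].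
  by rewrite ffunE eqxx scale1r addr0.
by rewrite ffunE (negPf g'g) scale0r.
Qed.

Lemma orbit_mapB x h z h' :
  orbit_map x (h - z *: h') = orbit_map x h - z *: orbit_map x h'.
Proof. by rewrite orbit_mapD -scaleNr orbit_mapZ scaleNr. Qed.

Lemma orbit_mapM x h c g : translates c g ->
  orbit_map x (sgmul h (monom K g)) = sgmul (orbit_map x h) (monom K c).
Proof.
move=> cg; elim/sgring_ind: h => [h h' Ih Ih'|z h Ih||g'].
- by rewrite sgmulDl !orbit_mapD Ih Ih' sgmulDl.
- by rewrite sgmulZl !orbit_mapZ Ih sgmulZl.
- by rewrite sgmul0l orbit_map0 sgmul0l.
rewrite monomM !orbit_map_monom monomM; congr monom.
by rewrite Algebra.addrC ffunE (translatesE _ cg) Algebra.addrC.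
Qed.

(** Distinct g move x to distinct points, so each coefficient of h can be read off. *)
Lemma orbit_map_inj x h : orbit_map x h = 0 -> h = 0.
Proof.
move=> h0; apply/ffunP => g; have := congr1 (fun f : sgring S K => f (val (val g x))) h0.
rewrite sum_ffunE (bigD1 g) //= big1 => [|g' g'g].
  by rewrite !ffunE eqxx [_ *: _]mulr1 addr0.
rewrite !ffunE; case: eqP => [/val_inj/schutz_free g_g'|]; last by rewrite [_ *: _]mulr0.
by rewrite g_g' eqxx in g'g.
Qed.

Lemma orbit_map_dfactorM x h c g z : translates c g ->
  orbit_map x (sgmul h (dfactor (g, z))) = sgmul (orbit_map x h) (dfactor (c, z)).
Proof.
move=> cg; rewrite /dfactor !sgmulDr !sgmulNr !sgmulZr orbit_mapB /=.
by rewrite (orbit_mapM _ _ cg) (orbit_mapM _ _ (translates_idem cg)).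
Qed.

Lemma orbit_map_dfactor x c g z : translates c g ->
  orbit_map x (dfactor (g, z)) = sgmul (monom K (val x)) (dfactor (c, z)).
Proof.
move=> cg; rewrite orbit_mapB !orbit_map_monom /= sgmulDr sgmulNr sgmulZr !monomM.
rewrite (translatesE x cg) (translatesE x (translates_idem cg)).
by rewrite ![val x + _]Algebra.addrC.
Qed.

Lemma orbit_map_foldl x h T G A : all2 translates T G ->
  orbit_map x (foldl (@sgmul _ _) h (map (@dfactor _ _) (zip G A))) =
  foldl (@sgmul _ _) (orbit_map x h) (map (@dfactor _ _) (zip T A)).
Proof.
elim: T G A h => [|c T IH] [|g G] [|z A] h //= /andP[cg TG].
by rewrite IH // (orbit_map_dfactorM _ _ _ cg).
Qed.

Lemma orbit_prod_neq0 x T G A :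
  all2 translates T G -> size A = size G -> (0 < size G)%N ->
  sgprod_neq0 (map (@dfactor _ K) (zip G A)) =
  (foldl (@sgmul _ _) (monom K (val x)) (map (@dfactor _ _) (zip T A)) != 0).
Proof.
case: T G A => [|c T] [|g G] [|z A] //= /andP[cg TG] _ _.
rewrite -(orbit_map_dfactor _ _ cg) -(orbit_map_foldl _ _ _ TG); congr (~~ _).
by apply/eqP/eqP => [->|/orbit_map_inj//]; rewrite orbit_map0.
Qed.

Lemma Hclass_refl : a \in Hclass a. Proof. by rewrite inE Hrel_refl. Qed.

Lemma dset_schutz l : dset (schutz a) K l -> dset S K l.
Proof.
case/dsetP => G <- GP; apply/dsetP.
have [T TG] : exists T, all2 translates T G.
  elim: G {GP} => [|g G [T TG]]; first by exists [::].
  by have [c _ cg] := translates_repr g; exists (c :: T); rewrite /= cg.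
have sTG : size T = size G by move: TG; rewrite all2E => /andP[/eqP].
exists T => // A sA nzA; rewrite sTG in sA.
have [G0|G0] := posnP (size G).
  by rewrite G0 in sTG sA; rewrite (size0nil sTG) (size0nil sA).
have := GP A sA nzA; rewrite (orbit_prod_neq0 (exist _ a Hclass_refl) TG) //=.
rewrite -sTG in sA G0; case: T A sA G0 {TG sTG nzA} => [|c T] [|z A] //= _ _.
by rewrite foldl_sgmulM; apply: contraNN => /eqP->; rewrite sgmul0r.
Qed.

Lemma dconst_schutz_le : (dconst (schutz a) K <= dconst S K)%E.
Proof.
apply: esup_le => [|l dl]; first exact: esup_ge0.
exact: esup_ub (dset_schutz dl).
Qed.

(** One choice of coefficients serves all y at once: it annihilates a product in K[Gamma(H_a)],
    which does not depend on the point acted upon. *)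
Lemma dset_schutzN T : all (mem (St (Hclass a))) T -> ~ dset (schutz a) K (size T) ->
  exists A : seq K, [/\ size A = size T, all (fun z => z != 0) A &
    forall y, y \in Hclass a ->
      foldl (@sgmul _ _) (monom K y) (map (@dfactor _ _) (zip T A)) = 0].
Proof.
move=> TS nd.
have [G TG] : exists G, all2 translates T G.
  elim: T TS {nd} => [_|c T IH /= /andP[cS /IH[G TG]]]; first by exists [::].
  by have [g cg] := translates_lift cS; exists (g :: G); rewrite /= cg.
have sTG : size T = size G by move: TG; rewrite all2E => /andP[/eqP].
have nG : ~ survives K G by move=> GP; apply: nd; apply/dsetP; exists G.
have [A [sA nzA A0]] := not_survives nG; exists A; split; rewrite ?sTG // => y yH.
(* The empty product counts as nonzero, so a vanishing product has a factor. *)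
have G0 : (0 < size G)%N.
  rewrite lt0n; apply: contraNN A0 => /eqP G0; rewrite G0 in sA.
  by rewrite (size0nil G0) (size0nil sA).
by move: A0; rewrite (orbit_prod_neq0 (exist _ y yH) TG) //= negbK => /eqP.
Qed.

End Schutzenberger.

(** * The upper bounds *)

Lemma subseq_map_lift (X Y : eqType) (f : X -> Y) s t :
  subseq t (map f s) -> exists2 s', subseq s' s & t = map f s'.
Proof.
case/subseqP => m sm ->; exists (mask m s); last by rewrite map_mask.
exact: mask_subseq.
Qed.

Section UpperBound.
Variables (S : finAddSemigroupType) (K : fieldType).
Implicit Types (a b c x y : S) (T : seq S).

Lemma foldl_principal x T : foldl +%R x T \in principal x.
Proof.
elim: T x => [|y T IH] x /=; first exact: principal_refl.
exact: principal_trans (IH _) (principalD _ _).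
Qed.

Lemma foldl_principal_mem x y T : y \in T -> foldl +%R x T \in principal (x + y).
Proof.
move=> /perm_to_rem/(perm_foldl (@Algebra.addrA S) (@Algebra.addrC S) x)->.
exact: foldl_principal.
Qed.

Lemma Hbar_eq a b : Hbar a = Hbar b <-> Hrel a b.
Proof. by split=> [/eqmodP|] // ab; apply/eqmodP. Qed.

Lemma HbarD a b : Hbar (a + b) = Hbar a + Hbar b.
Proof. exact/esym/Hquot_addE. Qed.

Lemma foldl_Hbar x T : foldl +%R (Hbar x) (map (@Hbar S) T) = Hbar (foldl +%R x T).
Proof. by elim: T x => //= y T IH x; rewrite -HbarD IH. Qed.

Lemma survives_group x T (b := foldl +%R x T) :
  idem b + b = b -> survives K (x :: T) -> dset (schutz b) K (size (x :: T)).
Proof.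
move=> eb xTP; apply: contrapT => nd.
have bb : Hrel (b + b) b.
  rewrite HrelE principalD -{1}eb principal_add ?idem_principal //.
  exact: principal_refl.
have /dset_schutzN/(_ nd)[[|z A] [//= [sA] nzA A0]] : all (mem (St (Hclass b))) (x :: T).
  (* Each term c has b in (c), so b + b lies in (b + c); since (b + b) = (b), this gives b in (c +
     b). *)
  apply/allP => c cT; apply: (St_Hclass (Hrel_refl b)).
  have bc : b \in principal c.
    move: cT; rewrite inE => /predU1P[->|cT]; first exact: foldl_principal.
    apply: principal_trans (foldl_principal_mem x cT) _.
    by rewrite Algebra.addrC principalD.
  rewrite HrelE Algebra.addrC principalD.
  have : b + b \in principal (b + c) by rewrite principal_add ?principal_refl.
  by apply: principal_trans; move: bb; rewrite HrelE => /andP[].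
have eH : idem b \in Hclass b.
  by rewrite inE HrelE idem_principal andbT -{1}eb principalD.
(* These coefficients kill X^(e(b)), as e(b) lies in H_b; but X^(e(b)) fixes the product, whose
   support lies in (b). *)
have /= := xTP (z :: A) (congr1 succn sA) nzA.
have bsupp := foldl_dfactor_supp (Z := zip T A) (@dfactor_supp S K (x, z)).
rewrite /= [unzip1 _]unzip1_zip ?sA // -/b in bsupp.
have := monom_absorb (fun u fu => principal_absorb eb (bsupp u fu)).
by rewrite -foldl_sgmulM (A0 _ eH) => <-; rewrite eqxx.
Qed.

Lemma survives_split x T (b := foldl +%R x T) :
  idem b + b <> b -> survives K (x :: T) ->
  exists T1 T2, [/\ size (x :: T) = (size T1 + size T2)%N,
    irreducible_with_sum (Hbar b) (map (@Hbar S) T1) & dset (schutz b) K (size T2)].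
Proof.
move=> neb xTP.
(* A shortest subsequence with sum b in S/H is irreducible. *)
pose P n := `[< exists T1, [/\ subseq T1 (x :: T),
  has_sum (map (@Hbar S) T1) (Hbar b) & size T1 = n] >].
have exP : exists n, P n.
  exists (size (x :: T)); apply/asboolP; exists (x :: T).
  by split; [exact: subseq_refl | exact: foldl_Hbar |].
case: (ex_minnP exP) => _ /asboolP[T1 [T1T T1b <-]] T1min.
have [T2 pT] := perm_to_subseq T1T; exists T1, T2; split.
- by rewrite (perm_size pT) size_cat.
- split=> // T0 /subseq_map_lift[T' T'T1 ->] nT' T'b; case/negP: nT'.
  have sT' : size T1 = size T'.
    apply/eqP; rewrite eqn_leq (size_subseq T'T1) andbT; apply: T1min; apply/asboolP.
    by exists T'; split=> //; exact: subseq_trans T1T.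
  by have [_] := size_subseq_leqif T'T1; rewrite sT' eqxx => /esym/eqP->.
(* If T1 were empty, b would be the identity of S/H; then b + b is H-related to b, which forces e(b)
   + b = b. *)
case: T1 T1T T1b pT {T1min} => [|y T1] T1T T1b pT.
  by case: neb; apply: Hrel_double; apply/Hbar_eq; rewrite HbarD; exact: T1b.
pose c := foldl +%R y T1; have cb : Hrel c b by apply/Hbar_eq; rewrite -foldl_Hbar.
have bE : b = foldl +%R c T2.
  by rewrite /c -foldl_cat; exact: (perm_foldl_cons (@Algebra.addrA S) (@Algebra.addrC S) pT).
apply: contrapT => nd.
have /dset_schutzN/(_ nd)[A [sA nzA A0]] : all (mem (St (Hclass b))) T2.
  apply/allP => d dT2; apply: (St_Hclass cb); rewrite HrelE Algebra.addrC principalD.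
  have := foldl_principal_mem c dT2; rewrite -bE; apply: principal_trans.
  by move: cb; rewrite HrelE => /andP[].
(* Any nonzero coefficients would do on T1; those in A on T2 kill the ideal (c), which contains the
   support of the product over T1. *)
have := survives_perm pT xTP (A := 1 :: nseq (size T1) 1 ++ A).
rewrite /= !size_cat size_nseq sA oner_eq0 all_cat nzA andbT all_nseq oner_eq0 orbT.
move=> /(_ erefl erefl); rewrite zip_cat ?size_nseq // map_cat foldl_cat.
set f := foldl _ _ (map _ (zip T1 _)).
suff -> : foldl (@sgmul S K) f (map (@dfactor S K) (zip T2 A)) = 0.
  by rewrite eqxx.
apply: foldl_sgmul_supp => u.
move=> /(foldl_dfactor_supp (@dfactor_supp S K (y, 1))).
rewrite [unzip1 _]unzip1_zip ?size_nseq // -/c.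
have cH : c \in Hclass b by rewrite inE Hrel_sym.
move=> /principalP[->|[t ->]]; first exact: A0.
by rewrite Algebra.addrC -monomM foldl_sgmulM A0 // sgmul0r.
Qed.

(* The partial sums of an irreducible sequence generate a strictly decreasing
   chain of ideals. *)
Lemma irreducible_chain a (T : seq (Hquot S)) : irreducible_with_sum (Hbar a) T ->
  (0 < size T)%N -> exists2 s, size s = (size T).-1 &
    path (fun x y => principal x \proper principal y) a s.
Proof.
elim/last_ind: T a => // T q IH a [Tq Tirr] _.
elim/quotW: q => q in Tq Tirr *.
case: T => [|p T] in IH Tq Tirr *; first by exists [::].
elim/quotW: p => p in IH Tq Tirr *.
have [T' TE] : exists T', T = map (@Hbar S) T'.
  exists (map repr T); rewrite -map_comp -[LHS]map_id.
  by apply: eq_map => r; rewrite /= [Hbar _]reprK.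
rewrite {}TE in IH Tq Tirr *.
pose b := foldl +%R p T'.
have bE : foldl +%R (Hbar p) (map (@Hbar S) T') = Hbar b by rewrite foldl_Hbar.
have aE : Hbar a = Hbar (b + q).
  by rewrite HbarD -bE -foldl_rcons; exact: esym Tq.
(* The prefix without q is irreducible: a proper subsequence with sum b, extended by q, would be one
   with sum a. *)
case: (IH b) => // [|s ss sP].
  split; first exact: bE.
  move=> T0 T0T nT0 T0b; apply: (Tirr (rcons T0 (Hbar q))).
  - by rewrite -!cats1 cat_subseq.
  - by apply: contraNN nT0 => /eqP/rcons_inj[->].
  rewrite aE HbarD; case: T0 T0b {T0T nT0} => [|t T0] /= T0b; first by rewrite T0b.
  by rewrite foldl_rcons T0b.
exists (b :: s); first by rewrite /= ss !size_rcons /=.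
rewrite /= {}sP andbT.
have -> : principal a = principal (b + q) by apply/eqP/Hbar_eq.
rewrite finset.properEneq principal_sub principalD andbT.
(* Were the two ideals equal, the prefix alone would already have sum a. *)
apply/negP => /eqP bq; have bq' : Hbar a = Hbar b by rewrite aE; apply/Hbar_eq/eqP.
case: (Tirr (Hbar p :: map (@Hbar S) T')).
- by rewrite -cats1 prefix_subseq.
- by apply/eqP => /(congr1 size)/eqP; rewrite size_rcons /= size_map ltn_eqF.
by rewrite bq'.
Qed.

Lemma davenport_le_psi a : (davenport (Hbar a) <= psi a + 1)%E.
Proof.
have psi0 : (0 <= psi a)%E := esup_ge0 _.
apply: esup_le => [|_ [T <- Tirr]]; first by rewrite adde_ge0.
have [->|T0] := posnP (size T); first by rewrite adde_ge0.
have [s ss sP] := irreducible_chain Tirr T0.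
(* A sequence of length k has k partial sums, the full sum included, so the chain above (a) has k -
   1 members. *)
rewrite -(prednK T0) -addn1 PoszD EFinD leeD2r //.
by apply: esup_ub; exists s.
Qed.

Lemma epsilonM a (v : \bar int) :
  ((epsilon a)%:Z%:E * v)%E = if `[< idem a + a = a >] then 0%E else v.
Proof.
by case: asboolP => [/epsilon0|/epsilon1] ->; rewrite ?mul0e ?mul1e.
Qed.

Lemma dset_le_max l : dset S K l -> (l%:Z%:E <= \big[maxe/0]_(a : S)
  ((epsilon a)%:Z%:E * davenport (Hbar a) + dconst (schutz a) K))%E.
Proof.
case/dsetP => -[|x T] <- TP; first exact: bigmax_ge_id.
apply: le_trans (le_bigmax _ _ (foldl +%R x T)); rewrite epsilonM.
case: asboolP => eb; first by rewrite add0e; exact: esup_ub (survives_group eb TP).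
have [T1 [T2 [-> T1irr T2d]]] := survives_split eb TP.
rewrite PoszD EFinD; apply: leeD; last exact: esup_ub.
by apply: esup_ub; exists (map (@Hbar S) T1); rewrite ?size_map.
Qed.

End UpperBound.

(** * Finiteness *)

Section Finiteness.
Variables (S : finAddSemigroupType) (K : fieldType).
Notation n := (exponent S).

Lemma exponent_gt0 : (0 < n)%N.
Proof.
apply: (big_ind (fun m => 0 < m)%N) => // [m k m0 k0|x _]; first by rewrite lcmn_gt0 m0.
by rewrite /sg_period; case: ex_minnP => m /andP[].
Qed.

(** For k the index, n s fixes k s because the period divides n; and e(s) = m s gives e(s) = k e(s)
    = (k m) s, a multiple of k s. *)
Lemma nfold_exponent (s : S) : nfold n s + idem s = idem s.
Proof.
have [k0 p0 kp] : [/\ (0 < sg_index s)%N, (0 < sg_period s)%N &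
    nfold (sg_index s + sg_period s) s = nfold (sg_index s) s].
  rewrite /sg_period; case: ex_minnP => p /andP[p0 /eqP kp] _; split=> //.
  by rewrite /sg_index; case: ex_minnP => k /andP[].
have /dvdnP[q nE] : (sg_period s %| n)%N by apply: (biglcmn_sup s).
move: (sg_index s) (sg_period s) k0 p0 kp nE => k p k0 p0 kp nE.
have kqp j : nfold (k + j * p) s = nfold k s.
  elim: j => [|j IH]; first by rewrite addn0.
  have [->|j0] := posnP j; first by rewrite mul1n.
  by rewrite mulSn addnA nfoldD ?addn_gt0 ?k0 ?muln_gt0 ?j0 // kp -nfoldD ?muln_gt0 ?j0.
have kn : nfold n s + nfold k s = nfold k s.
  by rewrite -nfoldD ?exponent_gt0 // addnC nE.
have [m m0 e] := idem_nfold s.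
have <- : nfold (k * m) s = idem s by rewrite nfold_mul // -e nfold_id ?idemD.
case: m m0 {e} => [//|[|m]] _; first by rewrite muln1.
by rewrite mulnS nfoldD ?muln_gt0 ?k0 // Algebra.addrA kn.
Qed.

Section OneElement.
Variable s : S.
Local Notation e := (idem s).

(** Unlike [nfold], meaningful at j = 0, where it is the idempotent. *)
Definition multiple j : S := iter j (+%R s) e.

Lemma multiple_absorb j : e + multiple j = multiple j.
Proof. by elim: j => [|j IH]; rewrite ?idemD //= Algebra.addrCA IH. Qed.

Lemma multipleE j : (0 < j)%N -> multiple j = nfold j s + e.
Proof.
elim: j => [//|[//|j] IH _].
by rewrite nfoldS // -Algebra.addrA -IH.
Qed.

(** The value of q, cut off after m coefficients, at X^(s + e), with X^e as the unit. *)
Definition poly_eval m (q : {poly K}) : sgring S K :=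
  \sum_(j < m) q`_j *: monom K (multiple j).

Lemma poly_evalM m (q : {poly K}) z : (size q <= m)%N ->
  poly_eval m.+1 (q * ('X - z%:P)) = sgmul (poly_eval m q) (dfactor (s, z)).
Proof.
move=> qm; rewrite (big_morph _ (fun f g => sgmulDl f g _) (sgmul0l _)).
transitivity (\sum_(j < m) q`_j *: (monom K (multiple j.+1) - z *: monom K (multiple j))).
  rewrite /poly_eval mulrBr; under eq_bigr do rewrite coefB coefMX coefMC scalerBl.
  rewrite sumrB big_ord_recl /= scale0r add0r big_ord_recr /= nth_default //.
  rewrite mul0r scale0r addr0 -sumrB; apply: eq_bigr => j _.
  by rewrite scalerBr scalerA.
apply: eq_bigr => j _; rewrite sgmulZl; congr (_ *: _).
rewrite sgmulDr sgmulNr sgmulZr !monomM /=.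
by rewrite [multiple j + s]Algebra.addrC [multiple j + e]Algebra.addrC multiple_absorb.
Qed.

Lemma poly_eval_foldl (zs : seq K) :
  foldl (@sgmul S K) (monom K e) [seq dfactor (s, z) | z <- zs] =
  poly_eval (size zs).+1 (\prod_(z <- zs) ('X - z%:P)).
Proof.
elim/last_ind: zs => [|zs z IH].
  by rewrite big_nil /= /poly_eval big_ord1 coef1 scale1r.
rewrite map_rcons foldl_rcons IH -poly_evalM ?size_prod_XsubC //.
by rewrite size_rcons -cats1 big_cat big_seq1.
Qed.

Variable zs : seq K.
Hypothesis zsP : 'X^n - 1 = \prod_(z <- zs) ('X - z%:P).

Lemma size_unity_roots : size zs = n.
Proof.
have := congr1 (fun q : {poly K} => size q) zsP.
by rewrite /= size_prod_XsubC -polyC1 size_XnsubC ?exponent_gt0 // => -[].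
Qed.

Lemma unity_root_neq0 z : z \in zs -> z != 0.
Proof.
move=> zzs; have : root ('X^n - 1) z by rewrite zsP root_prod_XsubC.
rewrite rootE !hornerE; apply: contraTneq => ->.
by rewrite expr0n eqn0Ngt exponent_gt0 add0r oppr_eq0 oner_eq0.
Qed.

(** The product is the value of ['X^n - 1], namely X^(n s + e) - X^e, and n s + e = e. *)
Lemma idem_unity_product :
  foldl (@sgmul S K) (monom K e) [seq dfactor (s, z) | z <- zs] = 0.
Proof.
rewrite poly_eval_foldl -zsP size_unity_roots /poly_eval.
case: n exponent_gt0 (nfold_exponent s) => // m _ me.
rewrite big_ord_recl big_ord_recr /= big1 => [|j _].
  rewrite !coefB !coefXn !coef1 /= eqxx sub0r subr0 scaleN1r scale1r add0r.
  by rewrite -[s + _]/(multiple m.+1) multipleE // me addrC subrr.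
by rewrite coefB coefXn coef1 /= ltn_eqF ?ltnS // subrr scale0r.
Qed.

(** X^e annihilates the left factor, so z drops out and only multiplication by X^s remains. *)
Lemma nilpotent_part (x : S) z :
  sgmul (monom K x - monom K (x + e)) (dfactor (s, z)) =
  monom K (x + s) - monom K (x + s + e).
Proof.
rewrite sgmulDl sgmulNl !sgmulDr !sgmulNr !sgmulZr !monomM /=.
by rewrite -[x + e + e]Algebra.addrA idemD (Algebra.addrAC x e) opprB addrA subrK.
Qed.

Lemma nilpotent_foldl m (A : seq K) : (0 < m)%N ->
  foldl (@sgmul S K) (monom K (nfold m s) - monom K (nfold m s + e))
    [seq dfactor (s, z) | z <- A] =
  monom K (nfold (m + size A) s) - monom K (nfold (m + size A) s + e).
Proof.
elim: A m => [|z A IH] m m0 /=; first by rewrite addn0.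
by rewrite nilpotent_part [_ + s]Algebra.addrC -nfoldS // IH // addSnnS.
Qed.

(* X^s - z X^e splits as (X^s - X^(s+e)) + (X^(s+e) - z X^e), and these two
   parts annihilate each other: enough factors kill the first part because it is
   nilpotent, and the factors z running over the n-th roots of unity kill the
   second one. *)
Lemma unity_product : exists A : seq K, all (fun z => z != 0) A /\
  ~~ sgprod_neq0 [seq dfactor (s, z) | z <- A].
Proof.
have [N N0 eN] := idem_nfold s.
(* The leading factor is the one that gets split. The entries zs kill its group part, and the last N
   raise the multiple of s in the other part past N, where adding e = N s changes nothing. *)
exists (1 :: zs ++ nseq N 1); split.
  rewrite /= oner_eq0 all_cat all_nseq oner_eq0 orbT andbT.
  by apply/allP => z; exact: unity_root_neq0.
rewrite /sgprod_neq0 /= negbK; set R := map _ _; apply/eqP.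
have R0 : foldl (@sgmul S K) (monom K e) R = 0.
  by rewrite /R map_cat foldl_cat idem_unity_product foldl_sgmul0.
have -> : dfactor (s, 1) = (monom K (nfold 1 s) - monom K (nfold 1 s + e)) +
    (sgmul (monom K s) (monom K e) - 1 *: monom K e).
  by rewrite monomM addrA subrK.
rewrite foldl_sgmulD nilpotent_foldl // foldl_sgmulD -scaleNr foldl_sgmulZ.
rewrite foldl_sgmulM R0 sgmul0r scaler0 !addr0 size_cat size_nseq addnA.
by rewrite nfoldD ?addn_gt0 // -eN -Algebra.addrA idemD subrr.
Qed.

End OneElement.

Lemma size_sum_count_mem (T : seq S) : size T = (\sum_(s : S) count_mem s T)%N.
Proof.
elim: T => [|x T IH]; first by rewrite big1.
rewrite /= big_split /= -IH (bigD1 x) //= eqxx big1 // => y xy.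
by rewrite eq_sym (negPf xy).
Qed.

(** If s occurs in T at least as often as [A s] has entries, the coefficients [A s] on these copies
    kill the whole product; summing over s bounds the length of T. *)
Lemma dset_bounded (zs : seq K) : 'X^n - 1 = \prod_(z <- zs) ('X - z%:P) ->
  exists M, forall l, dset S K l -> (l <= M)%N.
Proof.
move=> zsP; have /choice[A AP] := fun s => unity_product s zsP.
exists (\sum_(s : S) size (A s))%N => _ /dsetP[T <- TP].
rewrite size_sum_count_mem; apply: leq_sum => s _; rewrite leqNgt.
apply/negP => /ltnW sA; have [nzA /negP[]] := AP s.
have /perm_to_subseq[T' pT] : subseq (nseq (size (A s)) s) T.
  apply: subseq_trans (filter_subseq (pred1 s) T).
  have -> : filter (pred1 s) T = nseq (count_mem s T) s.
    by rewrite -size_filter; apply/all_pred1P; exact: filter_all.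
  by rewrite -(subnK sA) nseqD suffix_subseq.
have := survives_perm pT TP (A := A s ++ nseq (size T') 1).
rewrite !size_cat !size_nseq all_cat nzA all_nseq oner_eq0 orbT => /(_ erefl erefl).
rewrite zip_cat ?size_nseq // map_cat => /sgprod_neq0_catl.
suff -> : map (@dfactor S K) (zip (nseq (size (A s)) s) (A s)) =
  [seq dfactor (s, z) | z <- A s] by [].
by elim: (A s) => //= z B ->.
Qed.

(** In characteristic p, n is a power of p and ['X^n - 1] equals [('X - 1) ^+ n]; over a splitting
    field there are n distinct roots. *)
Lemma unity_roots_split :
  splitting_field S K \/ (exists2 p : nat, prime p /\ p \in [pchar K] &
                          exists k : nat, n = (p ^ k)%N) ->
  exists zs : seq K, 'X^n - 1 = \prod_(z <- zs) ('X - z%:P).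
Proof.
case=> [|[p [pp pK] [k nE]]]; last first.
  have pX : p \in [pchar {poly K}] by rewrite pchar_poly.
  have nX : [pchar {poly K}].-nat n.
    by rewrite (eq_pnat _ (pcharf_eq pX)) nE pnatX pnat_id.
  exists (nseq n 1); transitivity (('X - 1 : {poly K}) ^+ n).
    by rewrite (exprDn_pchar 'X (- 1) nX) exprNn_pchar ?expr1n.
  elim: n => [|m IH]; first by rewrite big_nil.
  by rewrite /= big_cons -IH exprS.
case/card_set_bijP => f [_ _ fsurj].
have /choice[g gP] (i : 'I_n) : exists z : K, z ^+ n = 1 /\ f z = i.
  by have [z zn fz] := fsurj i (ltn_ord i); exists z.
have ginj : injective g by move=> i j ij; apply: val_inj; rewrite /= -(gP i).2 ij (gP j).2.
exists (codom g).
rewrite {1}(@all_roots_prod_XsubC _ ('X^n - 1) (codom g)).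
- by rewrite -[in lead_coef _]polyC1 lead_coefXnsubC ?exponent_gt0 // scale1r.
- by rewrite size_codom card_ord -polyC1 size_XnsubC ?exponent_gt0.
- by apply/allP => _ /codomP[i ->]; rewrite rootE !hornerE (gP i).1 subrr.
by rewrite uniq_rootsE; apply/injectiveP.
Qed.

End Finiteness.

(** * Clifford and archimedean semigroups *)

Section SpecialClasses.
Variables (S : finAddSemigroupType) (K : fieldType).
Implicit Types (a c x y : S) (T : seq S).

Lemma clifford_idem : clifford S -> forall a, idem a + a = a.
Proof.
move=> cS a; have [a' [aa'a _]] := cS a; apply: Hrel_double.
rewrite HrelE principalD -{1}aa'a Algebra.addrAC; exact: principalD.
Qed.

Hypothesis archS : archimedean S.

Lemma archimedean_idem x y : idem x = idem y.
Proof.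
have absorb (u v : S) : idem u + idem v = idem u.
  have [m [t [_]]] := archS (idem u) (idem v); rewrite nfold_id ?idemD // => ->.
  by rewrite -Algebra.addrA idemD.
by rewrite -(absorb x y) Algebra.addrC absorb.
Qed.

(** As c + a generates (a), some d satisfies d + a = a; then e(d) fixes a, and e(d) = e(a) because
    the idempotent is unique. *)
Lemma archimedean_St a c : c \in St (Hclass a) -> idem a + a = a.
Proof.
rewrite inE => /fintype.subsetP/(_ (c + a)).
rewrite imset_f ?Hclass_refl // => /(_ isT); rewrite inE HrelE => /andP[+ _].
move=> /principalP aE.
have [d da] : exists d, d + a = a.
  case: aE => [|[t]] aE; first by exists c.
  by exists (c + t); rewrite Algebra.addrAC.
by rewrite (archimedean_idem a d) idem_absorb.
Qed.

(** Each strict inclusion of (a) in (b) splits off a summand, a = b + t. *)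
Lemma chain_sum a s : path (fun x y => principal x \proper principal y) a s ->
  exists x T, size T = size s /\ foldl +%R x T = a.
Proof.
elim: s a => [|b s IH] a /=; first by exists a, [::].
case/andP => ab /IH[x [T [sT xT]]].
have [t at_] : exists t, a = b + t.
  have /principalP[aE|//] : a \in principal b by rewrite -principal_sub proper_sub.
  by move: ab; rewrite aE fintype.properxx.
by exists x, (rcons T t); rewrite size_rcons sT foldl_rcons xT at_.
Qed.

Lemma dfactor_archimedean a (z : S * K) :
  dfactor z = monom K z.1 - z.2 *: monom K (idem a).
Proof. by rewrite /dfactor (archimedean_idem z.1 a). Qed.

(* Modulo the ideal generated by X^e a product is the monomial of the sum. *)
Lemma foldl_archimedean a x (f : sgring S K) (Z : seq (S * K)) :
  (exists2 h, sgmul h (monom K (idem a)) = h & f = monom K x + h) ->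
  exists2 h, sgmul h (monom K (idem a)) = h &
    foldl (@sgmul S K) f (map (@dfactor S K) Z) =
    monom K (foldl +%R x (unzip1 Z)) + h.
Proof.
elim: Z f x => [|[t w] Z IH] f x [h he fE]; first by exists h.
apply: IH; exists (sgmul h (dfactor (t, w)) - w *: monom K (x + idem a)).
  rewrite sgmulDl sgmulNl sgmulZl monomM -Algebra.addrA idemD.
  by rewrite sgmulAC he.
rewrite fE sgmulDl {1}(dfactor_archimedean a) sgmulDr sgmulNr sgmulZr !monomM.
by rewrite -addrA [- _ + _]addrC.
Qed.

(** If the product vanished, X^b = -h would be fixed by X^(e(b)), that is e(b) + b = b. *)
Lemma archimedean_survives x T (b := foldl +%R x T) :
  idem b + b <> b -> survives K (x :: T).
Proof.
move=> neb [|z A] //= [sA] _.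
have [|h he ->] := @foldl_archimedean b x (dfactor (x, z)) (zip T A).
  exists (- (z *: monom K (idem b))); last exact: dfactor_archimedean.
  by rewrite sgmulNl sgmulZl monomM idemD.
rewrite [unzip1 _]unzip1_zip ?sA // -/b; apply/eqP => bh0; apply: neb.
have hE : h = - monom K b by apply/eqP; rewrite -addr_eq0 addrC bh0.
have := he; rewrite hE sgmulNl monomM => /oppr_inj/ffunP/(_ b).
rewrite !ffunE eqxx; case: eqP => [be _|_ /eqP]; last by rewrite eq_sym oner_eq0.
by rewrite Algebra.addrC -be.
Qed.

Lemma archimedean_ge a : ((epsilon a)%:Z%:E * (psi a + 1) + dconst (schutz a) K <=
  dconst S K)%E.
Proof.
rewrite epsilonM; case: asboolP => ea.
  by rewrite add0e dconst_schutz_le.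
(* The Schützenberger group is empty here, so only the empty sequence is left. *)
have -> : dconst (schutz a) K = 0%E.
  apply: (@esup_max _ 0%N) => [|l /dsetP[[|g G] <- //]].
    by apply/dsetP; exists [::] => // -[].
  by have [c /archimedean_St] := translates_repr g.
(* A chain of length l above (a) writes a as a sum of l + 1 elements. *)
rewrite adde0; apply: esup_succ_le => [|l [s <- /chain_sum[x [T [sT xT]]]]].
  by exists [::].
apply: esup_ub; apply/dsetP; exists (x :: T); rewrite /= ?sT //.
by apply: archimedean_survives; rewrite xT.
Qed.

End SpecialClasses.

Local Open Scope ereal_scope.

Theorem theorem3p2 (S : finAddSemigroupType) (K : fieldType)
  (hK : splitting_field S K \/
        exists2 p : nat, prime p /\ p \in [pchar K]%R &
                         exists k : nat, exponent S = (p ^ k)%N) :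
  [/\ dconst S K < +oo,
      \big[maxe/0]_(a : S) dconst (schutz a) K <= dconst S K,
      dconst S K <=
        \big[maxe/0]_(a : S)
          ((epsilon a)%:Z%:E * davenport (Hbar a) + dconst (schutz a) K),
      \big[maxe/0]_(a : S)
          ((epsilon a)%:Z%:E * davenport (Hbar a) + dconst (schutz a) K) <=
        \big[maxe/0]_(a : S)
          ((epsilon a)%:Z%:E * (psi a + 1) + dconst (schutz a) K)
    & clifford S \/ archimedean S ->
      dconst S K =
        \big[maxe/0]_(a : S)
          ((epsilon a)%:Z%:E * (psi a + 1) + dconst (schutz a) K)].
Proof.
have le_dav : dconst S K <= \big[maxe/0]_(a : S)
    ((epsilon a)%:Z%:E * davenport (Hbar a) + dconst (schutz a) K).
  by apply: esup_le => [|l]; [exact: bigmax_ge_id | exact: dset_le_max].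
have dav_psi : \big[maxe/0]_(a : S)
    ((epsilon a)%:Z%:E * davenport (Hbar a) + dconst (schutz a) K) <=
    \big[maxe/0]_(a : S) ((epsilon a)%:Z%:E * (psi a + 1) + dconst (schutz a) K).
  apply: le_bigmax2 => a _; apply: leeD => //; rewrite !epsilonM.
  by case: asboolP => // _; exact: davenport_le_psi.
split=> //.
- have [zs /dset_bounded[M dM]] := unity_roots_split hK.
  apply: (@le_lt_trans _ _ M%:Z%:E); last exact: ltry.
  by apply: esup_le => [|l /dM]; rewrite lee_fin.
- apply: bigmax_le => [|a _]; [exact: esup_ge0 | exact: dconst_schutz_le].
(* Only the lower bound remains, term by term. In the Clifford case every [epsilon a] is 0, which
   leaves the bound by [dconst (schutz a) K]. *)
move=> special; apply/le_anti; rewrite (le_trans le_dav dav_psi) /=.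
apply: bigmax_le => [|a _]; first exact: esup_ge0.
case: special => [/clifford_idem cS|aS]; last exact: archimedean_ge.
by rewrite epsilonM; case: asboolP => // _; rewrite add0e dconst_schutz_le.
Qed.
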